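(* Let $n$ and $m$ be positive integers. For all real constants $a_i,t_i$ ($i=1,\ldots,m$), the product of the $n\times n$ matrices $\mathbf{M}(a_i,t_i)$ is $$\prod_{i=1}^{m}\mathbf{M}(a_i,t_i)=\mathbf{M}(a_\times,t_\times),$$ where $$a_\times=\frac{1}{n}\left(\prod_{i=1}^{m}(a_i-t_i+nt_i)+(n-1)\prod_{i=1}^{m}(a_i-t_i)\right),$$ $$t_\times=\frac{1}{n}\left(\prod_{i=1}^{m}(a_i-t_i+nt_i)-\prod_{i=1}^{m}(a_i-t_i)\right).$$ In particular, products of matrices of the form $\mathbf{M}(a,t)$ are commutative and associative.
   Context: For $a,t\in\mathbb{R}$, $\mathbf{M}(a,t)=(a-t)\cdot\mathbf{I}_{n\times n}+t\cdot\mathbf{1}_{n\times n}$ is the $n\times n$ double-constant matrix, with every diagonal entry equal to $a$ and every off-diagonal entry equal to $t$. Here $\mathbf{I}_{n\times n}$ is the identity matrix and $\mathbf{1}_{n\times n}$ is the matrix all of whose entries equal $1$. *)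

(* Defs.v *)
From HB Require Import structures.
From mathcomp Require Import all_boot all_order all_algebra.
From mathcomp Require Import reals.

Set Implicit Arguments.
Unset Strict Implicit.
Unset Printing Implicit Defensive.

Import Order.TTheory GRing.Theory Num.Theory.

Local Open Scope ring_scope.

Definition double_const_mx (R : realType) (n : nat) (a t : R) : 'M[R]_n :=
  (a - t) *: 1%:M + t *: const_mx 1.

Lemma double_const_mxE (R : realType) (n : nat) (a t : R) (i j : 'I_n) :
  double_const_mx n a t i j = if i == j then a else t.
Proof.
rewrite !mxE mulr1; case: eqP => _ /=; first by rewrite mulr1 subrK.
by rewrite mulr0 add0r.
Qed.

(* Main.v *)
Require Import Defs.
From mathcomp Require Import all_boot all_order all_algebra.
From mathcomp Require Import reals ring.

Set Implicit Arguments.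
Unset Strict Implicit.
Unset Printing Implicit Defensive.

Import Order.TTheory GRing.Theory Num.Theory.

Local Open Scope ring_scope.

(** M(a, t) has eigenvalue a - t + n t on the constant vectors and a - t on
    their complement, the zero-sum vectors.  These two eigenspaces do not depend
    on a and t, so the eigenvalues of a product are the products of the
    eigenvalues, and a, t are recovered from the eigenvalues linearly. *)

Lemma mul_const_mx1 (R : pzSemiRingType) (m n p : nat) :
  (const_mx 1 : 'M[R]_(m, n)) *m (const_mx 1 : 'M[R]_(n, p)) =
  n%:R *: const_mx 1.
Proof.
apply/matrixP => i j; rewrite !mxE mulr1.
under eq_bigr do rewrite !mxE mulr1.
by rewrite sumr_const card_ord.
Qed.

(** Expanding in the identity and the all-ones matrix J leaves only J J = n J to evaluate. The
    factor n - 2 counts the inner indices k other than i and j in an off-diagonal entry. *)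
Lemma mul_double_const_mx (R : realType) (n : nat) (a t b s : R) :
  double_const_mx n a t *m double_const_mx n b s =
  double_const_mx n (a * b + (n%:R - 1) * (t * s))
                    (a * s + t * b + (n%:R - 2) * (t * s)).
Proof.
rewrite /double_const_mx mulmxDl !mulmxDr -!scalemxAl -!scalemxAr.
rewrite !mul1mx mulmx1 mul_const_mx1; apply/matrixP => i j; rewrite !mxE.
by ring.
Qed.

(* Eigenvalue p on the constant vectors, q on the zero-sum vectors. *)
Definition double_const_mx_eigen (R : realType) (n : nat) (p q : R) : 'M[R]_n :=
  double_const_mx n (n%:R^-1 * (p + (n%:R - 1) * q)) (n%:R^-1 * (p - q)).

(** Solves p = a - t + n t, q = a - t for a and t, which requires dividing by n. *)
Lemma double_const_mx_eigenE (R : realType) (n : nat) (a t : R) : (0 < n)%N ->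
  double_const_mx n a t = double_const_mx_eigen n (a - t + n%:R * t) (a - t).
Proof.
move=> n_gt0; have n_neq0 : n%:R != 0 :> R by rewrite pnatr_eq0 -lt0n.
by rewrite /double_const_mx_eigen; congr double_const_mx; field.
Qed.

(** Base case of the product formula: the empty product, with both eigenvalues 1. *)
Lemma double_const_mx_eigen1 (R : realType) (n : nat) : (0 < n)%N ->
  double_const_mx_eigen n 1 1 = 1%:M :> 'M[R]_n.
Proof.
move=> n_gt0; have n_neq0 : n%:R != 0 :> R by rewrite pnatr_eq0 -lt0n.
rewrite /double_const_mx_eigen subrr mulr0 mulr1 [1 + _]addrC subrK mulVf //.
by rewrite /double_const_mx subr0 scale1r scale0r addr0.
Qed.

Lemma mul_double_const_mx_eigen (R : realType) (n : nat) (p q p' q' : R) :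
  (0 < n)%N ->
  double_const_mx_eigen n p q *m double_const_mx_eigen n p' q' =
  double_const_mx_eigen n (p * p') (q * q').
Proof.
move=> n_gt0; have n_neq0 : n%:R != 0 :> R by rewrite pnatr_eq0 -lt0n.
rewrite /double_const_mx_eigen mul_double_const_mx.
by congr double_const_mx; field.
Qed.

Theorem theorem5 (R : realType) (n m : nat) (hn : (0 < n)%N) (hm : (0 < m)%N) :
  (forall a t : 'I_m -> R,
     \prod_(i < m) double_const_mx n (a i) (t i) =
     double_const_mx n
       (n%:R^-1 * (\prod_(i < m) (a i - t i + n%:R * t i)
                   + (n%:R - 1) * \prod_(i < m) (a i - t i)))
       (n%:R^-1 * (\prod_(i < m) (a i - t i + n%:R * t i)
                   - \prod_(i < m) (a i - t i))))
  /\ (forall a1 t1 a2 t2 : R,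
        double_const_mx n a1 t1 *m double_const_mx n a2 t2 =
        double_const_mx n a2 t2 *m double_const_mx n a1 t1)
  /\ (forall a1 t1 a2 t2 a3 t3 : R,
        double_const_mx n a1 t1 *m (double_const_mx n a2 t2 *m double_const_mx n a3 t3) =
        (double_const_mx n a1 t1 *m double_const_mx n a2 t2) *m double_const_mx n a3 t3).
Proof.
split=> [a t|].
  (* The right-hand side is the matrix whose eigenvalues p and q are the two scalar products, so one
     induction can run on all three products at once. *)
  rewrite -/(double_const_mx_eigen _ _ _).
  elim/big_rec3: _ => [|i A p q _ ->]; first by rewrite double_const_mx_eigen1.
  by rewrite double_const_mx_eigenE // -mul_double_const_mx_eigen.
split=> *; last exact: mulmxA.
(* Both entries of the product formula are symmetric under swapping (a, t) with (b, s). *)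
by rewrite !mul_double_const_mx; congr double_const_mx; ring.
Qed.
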